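(* (The coherent critical branchings theorem) Assume that $X$ is a terminating left-monomial $1$-polygraph, and that $Y$ is a cellular extension of the free $1$-algebra $\mathcal{A}(X)$. If $X$ is critically $Y$-confluent, then $X$ is locally $Y$-confluent.
   Context: Fix a field $\mathbb{K}$; algebras are unital associative $\mathbb{K}$-algebras. A $1$-polygraph $X=\langle X_0\,|\,X_1\rangle$ is a set $X_0$ and a set $X_1$ (of ''$1$-cells'') with two maps $s,t:X_1\to\mathcal{A}(X_0)$ into the free algebra on $X_0$. Monomials are the elements of the free monoid $X_0^*$; $\mathrm{supp}(a)$ is the set of monomials with nonzero coefficient in $a\in\mathcal{A}(X_0)$. $X$ is left-monomial if, for each $\alpha\in X_1$, $s(\alpha)$ is a monomial not belonging to $\mathrm{supp}(t(\alpha))$. The free $1$-algebra $\mathcal{A}(X)$ has as $0$-cells the elements of $\mathcal{A}(X_0)$; its $1$-cells are the elements of the quotient of the $\mathcal{A}(X_0)$-bimodule $(\mathcal{A}(X_0)\otimes\mathbb{K}X_1\otimes\mathcal{A}(X_0))\oplus\mathcal{A}(X_0)$ by the sub-bimodule generated by the elements $(a s(b)+t(a)b-t(a)s(b))-(s(a)b+a t(b)-s(a)t(b))$ for $a,b$ in the first summand, where $s(a\alpha b)=a s(\alpha) b$, $t(a\alpha b)=a t(\alpha) b$, and an element $c$ of the second summand is the identity $1_c$, with source and target $c$. Composition of $f:a\to b$ and $g:b\to c$ is $f\star_0 g=f-1_b+g$. A $1$-monomial is a $1$-cell $u\alpha v$ with $u,v$ monomials and $\alpha\in X_1$. Let $X$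 be left-monomial. A rewriting step is a $1$-cell $\lambda f+1_a$ with $f$ a $1$-monomial, $\lambda\in\mathbb{K}\setminus\{0\}$ and $a$ a $0$-cell with $s(f)\notin\mathrm{supp}(a)$. A positive $1$-cell is a (possibly empty) composite of rewriting steps. Let $\succ_X$ be the smallest transitive relation on $X_0^*$ that is stable by product and such that $s(\alpha)\succ_X v$ for all $\alpha\in X_1$, $v\in\mathrm{supp}(t(\alpha))$; $X$ terminates if $\succ_X$ is wellfounded. A branching of $X$ is a pair of positive $1$-cells with the same source ($(f,g)$ and $(g,f)$ are not distinguished); it is local if both are rewriting steps. A critical branching is a pair $(f,g)$ of $1$-monomials with the same source such that: $f\neq g$ (not aspherical); $(f,g)$ is not, up to order, of the form $(f'v,ug')$ with $f':u\to a$, $g':v\to b$ $1$-monomials (not Peiffer); and $(f,g)$ cannot be written $u(f',g')v=(uf'v,ug'v)$ with $(f',g')$ a branching and $u,v$ monomials not both equal to $1$. A cellular extension $Y$ of $\mathcal{A}(X)$ is a set $Y$ with two maps $s,t$ from $Y$ to the $1$-cells of $\mathcal{A}(X)$ such that $s(y)$ and $t(y)$ have the same source and the same target. The free $2$-algebra $\mathcal{A}(X)[Y]$ extends $\mathcal{A}(X)$ with $2$-cells, namely the elements of the quotient of the $\mathcal{A}(X_0)$-bimodule $(\mathcal{A}(X_0)\otimes\mathbb{K}Y\otimes\mathcal{A}(X_0))\oplus\{1\text{-cells of }\mathcal{A}(X)\}$ by the sub-bimodule generated by the elements $(a s_0(b)+t_0(a)b-t_0(a)s_0(b))-(s_0(a)b+a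 t_0(b)-s_0(a)t_0(b))$ for $a,b$ in the first summand, with $s(ayb)=a s(y) b$, $t(ayb)=a t(y) b$, $s_0,t_0$ the $0$-dimensional source and target, and $s(f)=t(f)=f$ for $f$ in the second summand. A branching $(f,g)$ is $Y$-confluent if there exist positive $1$-cells $h,k$ and a $2$-cell $F:f\star_0 h\Rightarrow g\star_0 k$ in $\mathcal{A}(X)[Y]$. $X$ is locally (resp. critically) $Y$-confluent if every local (resp. critical) branching of $X$ is $Y$-confluent. *)

(* Defs.v *)
From HB Require Import structures.
From mathcomp Require Import all_boot all_order all_algebra.
From mathcomp Require Import finmap.
From mathcomp Require Import boolp.
From mathcomp.multinomials Require Import monalg.

Set Implicit Arguments.
Unset Strict Implicit.
Unset Printing Implicit Defensive.

Import GRing.Theory.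
Local Open Scope ring_scope.
Local Open Scope quotient_scope.

Declare Scope bimod_scope.
Delimit Scope bimod_scope with B.
Local Open Scope bimod_scope.

Reserved Notation "a *L v" (at level 40, left associativity).
Reserved Notation "v *R a" (at level 40, left associativity).

(* The free monoid {fmonom X0} has product mmul and unit mone. *)
Notation freeAlg K X0 := {malg K[{fmonom X0}]} (only parsing).

(* Bimodules over a K-algebra A. The last axiom says that K acts in the same
   way on both sides; the scalar multiple of v by k is k%:A *L v. *)
HB.mixin Record isBimodule (K : fieldType) (A : lalgType K) V
    of GRing.Zmodule V := {
  lact : A -> V -> V;
  ract : V -> A -> V;
  lactM : forall a b v, lact (a * b) v = lact a (lact b v);
  lact1 : forall v, lact 1 v = v;
  lactDl : forall a b v, lact (a + b) v = lact a v + lact b v;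
  lactDr : forall a v w, lact a (v + w) = lact a v + lact a w;
  ractM : forall a b v, ract v (a * b) = ract (ract v a) b;
  ract1 : forall v, ract v 1 = v;
  ractDr : forall a b v, ract v (a + b) = ract v a + ract v b;
  ractDl : forall a v w, ract (v + w) a = ract v a + ract w a;
  lractA : forall a b v, ract (lact a v) b = lact a (ract v b);
  lractC : forall (k : K) v, lact k%:A v = ract v k%:A
}.

#[short(type="bimodType")]
HB.structure Definition Bimodule (K : fieldType) (A : lalgType K) :=
  { V of isBimodule K A V & GRing.Zmodule V }.

Notation "a *L v" := (lact a v) : bimod_scope.
Notation "v *R a" := (ract v a) : bimod_scope.

Section BimoduleTheory.
Context (K : fieldType) (A : lalgType K) (V : bimodType A).
Implicit Types (a : A) (v w : V).

Lemma lact_is_zmod_morphism a : zmod_morphism (fun v => a *L v : V).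
Proof.
by move=> v w /=; apply/(addIr (a *L w)); rewrite -lactDr !addrNK.
Qed.

Lemma ract_is_zmod_morphism a : zmod_morphism (fun v => v *R a : V).
Proof.
by move=> v w /=; apply/(addIr (w *R a)); rewrite -ractDl !addrNK.
Qed.

Lemma lactBr a v w : a *L (v - w) = a *L v - a *L w.
Proof. exact: lact_is_zmod_morphism. Qed.

Lemma ractBl a v w : (v - w) *R a = v *R a - w *R a.
Proof. exact: ract_is_zmod_morphism. Qed.

Lemma lactBl a b v : (a - b) *L v = a *L v - b *L v.
Proof. by apply/(addIr (b *L v)); rewrite -lactDl !addrNK. Qed.

Lemma ractBr a b v : v *R (a - b) = v *R a - v *R b.
Proof. by apply/(addIr (v *R b)); rewrite -ractDr !addrNK. Qed.

Lemma lact0r a : a *L (0 : V) = 0.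
Proof. by rewrite -[X in _ *L X](subrr 0) lactBr subrr. Qed.

Lemma ract0l a : (0 : V) *R a = 0.
Proof. by rewrite -[X in X *R _](subrr 0) ractBl subrr. Qed.

Lemma lact0l v : (0 : A) *L v = 0.
Proof. by rewrite -[X in X *L _](subrr 0) lactBl subrr. Qed.

Lemma ract0r v : v *R (0 : A) = 0.
Proof. by rewrite -[X in _ *R X](subrr 0) ractBr subrr. Qed.
End BimoduleTheory.

Section ProdBimodule.
Context (K : fieldType) (A : lalgType K) (V W : bimodType A).
Implicit Types (a b : A) (z : V * W).

Let pl a z : V * W := (a *L z.1, a *L z.2).
Let pr z a : V * W := (z.1 *R a, z.2 *R a).

Fact prod_lactM a b z : pl (a * b) z = pl a (pl b z).
Proof. by rewrite /pl !lactM. Qed.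
Fact prod_lact1 z : pl 1 z = z.
Proof. by case: z => v w; rewrite /pl !lact1. Qed.
Fact prod_lactDl a b z : pl (a + b) z = pl a z + pl b z.
Proof. by rewrite /pl !lactDl. Qed.
Fact prod_lactDr a z z' : pl a (z + z') = pl a z + pl a z'.
Proof. by rewrite /pl !lactDr. Qed.
Fact prod_ractM a b z : pr z (a * b) = pr (pr z a) b.
Proof. by rewrite /pr !ractM. Qed.
Fact prod_ract1 z : pr z 1 = z.
Proof. by case: z => v w; rewrite /pr !ract1. Qed.
Fact prod_ractDr a b z : pr z (a + b) = pr z a + pr z b.
Proof. by rewrite /pr !ractDr. Qed.
Fact prod_ractDl a z z' : pr (z + z') a = pr z a + pr z' a.
Proof. by rewrite /pr !ractDl. Qed.
Fact prod_lractA a b z : pr (pl a z) b = pl a (pr z b).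
Proof. by rewrite /pl /pr !lractA. Qed.
Fact prod_lractC (k : K) z : pl k%:A z = pr z k%:A.
Proof. by rewrite /pl /pr !lractC. Qed.

HB.instance Definition _ := isBimodule.Build K A (V * W)%type
  prod_lactM prod_lact1 prod_lactDl prod_lactDr prod_ractM prod_ract1
  prod_ractDr prod_ractDl prod_lractA prod_lractC.
End ProdBimodule.

Section FreeAlgBimodule.
Context (K : fieldType) (X0 : choiceType).
Local Notation A := (freeAlg K X0).

Fact freeAlg_lractC (k : K) (v : A) : k%:A * v = v * k%:A.
Proof.
have -> : k%:A = k%:MP :> A by rewrite -mul_malgC mulr1.
rewrite mul_malgC [RHS]fgmulgU [v in LHS]monalgE scaler_sumr.
apply: eq_bigr => i _; apply/malgP => j; rewrite mcoeffZ (mulm1 i) !mcoeffU mulrnAr.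
by congr (_ *+ _); exact: mulrC.
Qed.

HB.instance Definition _ := @isBimodule.Build K A A *%R *%R
  (fun a b v => esym (mulrA a b v)) (@mul1r A)
  (fun a b v => mulrDl a b v) (fun a v w => mulrDr a v w)
  (fun a b v => mulrA v a b) (@mulr1 A) (fun a b v => mulrDr v a b)
  (fun a v w => mulrDl v w a) (fun a b v => esym (mulrA a v b))
  freeAlg_lractC.

Lemma lactE (a v : A) : a *L v = a * v. Proof. by []. Qed.
Lemma ractE (a v : A) : v *R a = v * a. Proof. by []. Qed.
End FreeAlgBimodule.

(* Locked definitions keep unification from unfolding monoid-algebra terms. *)
HB.lock Definition linext (K : fieldType) (I : choiceType) (V : lmodType K)
  (phi : I -> V) (x : {malg K[I]}) : V := \sum_(i <- msupp x) x@_i *: phi i.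

Section LinearExtension.
Context (K : fieldType) (I : choiceType) (V : lmodType K).
Implicit Types (phi : I -> V) (x : {malg K[I]}).

Lemma linextEw phi x (d : {fset I}) : (msupp x `<=` d)%fset ->
  linext phi x = \sum_(i <- d) x@_i *: phi i.
Proof.
move=> le; rewrite linext.unlock [LHS](big_fset_incl _ le) => //= i _ /mcoeff_outdom ->.
by rewrite scale0r.
Qed.

Lemma linextU phi c i : linext phi << c *g i >> = c *: phi i.
Proof. by rewrite (linextEw _ msuppU_le) big_seq_fset1 mcoeffUU. Qed.

Lemma linextD phi x y : linext phi (x + y) = linext phi x + linext phi y.
Proof.
rewrite (linextEw _ (msuppD_le x y)) (linextEw _ (fsubsetUl (msupp x) (msupp y))).
rewrite (linextEw _ (fsubsetUr (msupp x) (msupp y))).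
by rewrite -big_split; apply: eq_bigr => i _; rewrite mcoeffD scalerDl.
Qed.

Lemma linextZ phi c x : linext phi (c *: x) = c *: linext phi x.
Proof.
rewrite (linextEw _ (msuppZ_le _ _)) linext.unlock scaler_sumr.
by apply: eq_bigr => i _; rewrite mcoeffZ scalerA.
Qed.

Lemma linext_addphi phi psi x :
  linext (fun i => phi i + psi i) x = linext phi x + linext psi x.
Proof.
by rewrite linext.unlock -big_split; apply: eq_bigr => i _; rewrite scalerDr.
Qed.
End LinearExtension.

Lemma malg_additive_eq (K : fieldType) (I : choiceType) (V : zmodType)
    (f g : {malg K[I]} -> V) :
    (forall x y, f (x + y) = f x + f y) -> (forall x y, g (x + y) = g x + g y) ->
    (forall c i, f << c *g i >> = g << c *g i >>) -> f =1 g.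
Proof.
move=> fD gD fg x.
have f0 : f 0 = 0 by apply: (addrI (f 0)); rewrite -fD !addr0.
have g0 : g 0 = 0 by apply: (addrI (g 0)); rewrite -gD !addr0.
rewrite [x]monalgE (big_morph f fD f0) (big_morph g gD g0).
by apply: eq_bigr => i _; apply: fg.
Qed.

(* A(X0) (x) K E (x) A(X0), on its linear basis: the triple (u, e, v) stands
   for the element u e v with u, v monomials. *)
Definition freeBimod (K : fieldType) (X0 E : choiceType) :=
  {malg K[({fmonom X0} * E * {fmonom X0})%type]}.

HB.instance Definition _ K X0 E := GRing.Lmodule.on (@freeBimod K X0 E).

HB.lock Definition ctri (K : fieldType) (X0 E : choiceType) (c : K)
    (t : {fmonom X0} * E * {fmonom X0}) : freeBimod K X0 E := << c *g t >>.

Section FreeBimoduleTriples.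
Context (K : fieldType) (X0 E : choiceType).
Local Notation F := (freeBimod K X0 E).
Local Notation T := ({fmonom X0} * E * {fmonom X0})%type.

Definition tri (u : {fmonom X0}) (e : E) (v : {fmonom X0}) : F :=
  ctri 1 (u, e, v).

Definition triL (u : {fmonom X0}) (t : T) : T := (mmul u t.1.1, t.1.2, t.2).
Definition triR (t : T) (u : {fmonom X0}) : T := (t.1.1, t.1.2, mmul t.2 u).
End FreeBimoduleTriples.

HB.lock Definition freeBimod_lact (K : fieldType) (X0 E : choiceType)
    (a : freeAlg K X0) (x : freeBimod K X0 E) : freeBimod K X0 E :=
  linext (fun u => linext (fun t => ctri (1 : K) (triL u t)) x) a.

HB.lock Definition freeBimod_ract (K : fieldType) (X0 E : choiceType)
    (x : freeBimod K X0 E) (a : freeAlg K X0) : freeBimod K X0 E :=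
  linext (fun t => linext (fun u => ctri (1 : K) (triR t u)) a) x.

(* The bimodule morphism extending phi, i.e. u e v |-> u (phi e) v. *)
HB.lock Definition bimod_ext (K : fieldType) (X0 E : choiceType)
    (B : bimodType (freeAlg K X0)) (phi : E -> B) (x : freeBimod K X0 E) : B :=
  \sum_(t <- msupp x) (<< x@_t *g t.1.1 >> *L phi t.1.2) *R << t.2 >>.

Section FreeBimodule.
Context (K : fieldType) (X0 E : choiceType).
Local Notation A := (freeAlg K X0).
Local Notation F := (freeBimod K X0 E).
Local Notation T := ({fmonom X0} * E * {fmonom X0})%type.
Implicit Types (a b : A) (x y : F) (u v : {fmonom X0}) (t : T).
Implicit Types (c d : K).

Local Notation fl := (@freeBimod_lact K X0 E).
Local Notation fr := (@freeBimod_ract K X0 E).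

Lemma flDl a b x : fl (a + b) x = fl a x + fl b x.
Proof. by rewrite freeBimod_lact.unlock linextD. Qed.
Lemma flDr a x y : fl a (x + y) = fl a x + fl a y.
Proof.
rewrite freeBimod_lact.unlock -linext_addphi; congr linext.
by apply/funext => u; rewrite linextD.
Qed.
Lemma frDl a x y : fr (x + y) a = fr x a + fr y a.
Proof. by rewrite freeBimod_ract.unlock linextD. Qed.
Lemma frDr a b x : fr x (a + b) = fr x a + fr x b.
Proof.
rewrite freeBimod_ract.unlock -linext_addphi; congr linext.
by apply/funext => u; rewrite linextD.
Qed.

Lemma scaleU (I : choiceType) (c d : K) (i : I) :
  c *: (<< d *g i >> : {malg K[I]}) = << c * d *g i >>.
Proof. by apply/malgP=> j; rewrite mcoeffZ !mcoeffU mulrnAr. Qed.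

Lemma scale_ctri c d t : c *: ctri d t = ctri (c * d) t.
Proof. by rewrite ctri.unlock [LHS]scaleU. Qed.

Lemma linext_ctri (V : lmodType K) (phi : T -> V) c t :
  linext phi (ctri c t) = c *: phi t.
Proof. by rewrite ctri.unlock linextU. Qed.

Lemma flU c u d t : fl << c *g u >> (ctri d t) = ctri (c * d) (triL u t).
Proof. by rewrite freeBimod_lact.unlock linextU linext_ctri !scale_ctri mulr1. Qed.

Lemma frU c u d t : fr (ctri d t) << c *g u >> = ctri (d * c) (triR t u).
Proof. by rewrite freeBimod_ract.unlock linext_ctri linextU !scale_ctri mulr1. Qed.

Lemma freeBimod_additive_eq (V : zmodType) (f g : F -> V) :
    (forall x y, f (x + y) = f x + f y) -> (forall x y, g (x + y) = g x + g y) ->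
    (forall c t, f (ctri c t) = g (ctri c t)) -> f =1 g.
Proof.
move=> fD gD fg; apply: malg_additive_eq => // c t.
by move: (fg c t); rewrite ctri.unlock.
Qed.

Lemma malgMU (c d : K) u v :
  << c *g u >> * << d *g v >> = << c * d *g mmul u v >> :> A.
Proof. exact: fgmulUU. Qed.

Fact freeBimod_lactM a b x : fl (a * b) x = fl a (fl b x).
Proof.
apply: (malg_additive_eq (f := fun a => fl (a * b) x)
  (g := fun a => fl a (fl b x))) => {a} [a a'|a a'|c u].
- by rewrite mulrDl flDl.
- exact: flDl.
apply: (malg_additive_eq (f := fun b => fl (<< c *g u >> * b) x)
  (g := fun b => fl << c *g u >> (fl b x))) => {b} [b b'|b b'|d v].
- by rewrite mulrDr flDl.
- by rewrite flDl flDr.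
rewrite malgMU; apply: (freeBimod_additive_eq (f := fun x => fl << c * d *g mmul u v >> x)
  (g := fun x => fl << c *g u >> (fl << d *g v >> x))) => {x} [x x'|x x'|k t].
- exact: flDr.
- by rewrite !flDr.
by rewrite !flU /triL /= mulmA mulrA.
Qed.

Fact freeBimod_lact1 x : fl 1 x = x.
Proof.
apply: (freeBimod_additive_eq (f := fun x => fl 1 x) (g := id)) => {x} // [x x'|k [[u e] v]].
  exact: flDr.
by rewrite flU /triL /= mul1r mul1m.
Qed.

Fact freeBimod_ractM a b x : fr x (a * b) = fr (fr x a) b.
Proof.
apply: (malg_additive_eq (f := fun a => fr x (a * b))
  (g := fun a => fr (fr x a) b)) => {a} [a a'|a a'|c u].
- by rewrite mulrDl frDr.
- by rewrite frDr frDl.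
apply: (malg_additive_eq (f := fun b => fr x (<< c *g u >> * b))
  (g := fun b => fr (fr x << c *g u >>) b)) => {b} [b b'|b b'|d v].
- by rewrite mulrDr frDr.
- exact: frDr.
rewrite malgMU; apply: (freeBimod_additive_eq (f := fun x => fr x << c * d *g mmul u v >>)
  (g := fun x => fr (fr x << c *g u >>) << d *g v >>)) => {x} [x x'|x x'|k t].
- exact: frDl.
- by rewrite !frDl.
by rewrite !frU /triR /= mulmA mulrA.
Qed.

Fact freeBimod_ract1 x : fr x 1 = x.
Proof.
apply: (freeBimod_additive_eq (f := fun x => fr x 1) (g := id)) => {x} // [x x'|k [[u e] v]].
  exact: frDl.
by rewrite frU /triR /= mulr1 mulm1.
Qed.

Fact freeBimod_lractA a b x : fr (fl a x) b = fl a (fr x b).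
Proof.
apply: (malg_additive_eq (f := fun a => fr (fl a x) b)
  (g := fun a => fl a (fr x b))) => {a} [a a'|a a'|c u].
- by rewrite flDl frDl.
- exact: flDl.
apply: (malg_additive_eq (f := fun b => fr (fl << c *g u >> x) b)
  (g := fun b => fl << c *g u >> (fr x b))) => {b} [b b'|b b'|d v].
- exact: frDr.
- by rewrite frDr flDr.
apply: (freeBimod_additive_eq (f := fun x => fr (fl << c *g u >> x) << d *g v >>)
  (g := fun x => fl << c *g u >> (fr x << d *g v >>))) => {x} [x x'|x x'|k t].
- by rewrite flDr frDl.
- by rewrite frDl flDr.
by rewrite flU frU frU flU mulrA.
Qed.

Fact freeBimod_lractC (k : K) x : fl k%:A x = fr x k%:A.
Proof.
rewrite -mul_malgC mulr1.
apply: (freeBimod_additive_eq (f := fun x => fl k%:MP x)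
  (g := fun x => fr x k%:MP)) => {x} [x x'|x x'|c [[u e] v]].
- exact: flDr.
- exact: frDl.
by rewrite flU frU /triL /triR /= mul1m mulm1 mulrC.
Qed.

HB.instance Definition _ := isBimodule.Build K A F
  freeBimod_lactM freeBimod_lact1 flDl flDr freeBimod_ractM freeBimod_ract1
  (fun a b x => frDr a b x) (fun a x y => frDl a x y)
  freeBimod_lractA freeBimod_lractC.

Lemma lact_ctri c u d t : << c *g u >> *L ctri d t = ctri (c * d) (triL u t).
Proof. exact: flU. Qed.

Lemma ract_ctri c u d t : ctri d t *R << c *g u >> = ctri (d * c) (triR t u).
Proof. exact: frU. Qed.

Lemma bimod_extEw (B : bimodType A) (phi : E -> B) (x : F) (d : {fset T}) :
  (msupp (x : {malg K[T]}) `<=` d)%fset ->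
  bimod_ext phi x =
    \sum_(t <- d) (<< x@_t *g t.1.1 >> *L phi t.1.2) *R << t.2 >>.
Proof.
move=> le; rewrite bimod_ext.unlock (big_fset_incl _ le) => //= t _ /mcoeff_outdom ->.
by rewrite monalgU0 lact0l ract0l.
Qed.

Lemma bimod_ext_ctri (B : bimodType A) (phi : E -> B) c t :
  bimod_ext phi (ctri c t) = (<< c *g t.1.1 >> *L phi t.1.2) *R << t.2 >>.
Proof.
by rewrite ctri.unlock (bimod_extEw _ msuppU_le) big_seq_fset1 mcoeffUU.
Qed.

Lemma bimod_extD (B : bimodType A) (phi : E -> B) x y :
  bimod_ext phi (x + y) = bimod_ext phi x + bimod_ext phi y.
Proof.
rewrite (bimod_extEw _ (msuppD_le x y)).
rewrite (bimod_extEw _ (fsubsetUl (msupp x) (msupp y))).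
rewrite (bimod_extEw _ (fsubsetUr (msupp x) (msupp y))) -big_split.
by apply: eq_bigr => t _; rewrite mcoeffD monalgUD lactDl ractDl.
Qed.

Lemma bimod_ext0 (B : bimodType A) (phi : E -> B) : bimod_ext phi 0 = 0.
Proof. by apply: (addrI (bimod_ext phi 0)); rewrite -bimod_extD !addr0. Qed.

Lemma bimod_extB (B : bimodType A) (phi : E -> B) x y :
  bimod_ext phi (x - y) = bimod_ext phi x - bimod_ext phi y.
Proof. by apply: (addIr (bimod_ext phi y)); rewrite -bimod_extD !addrNK. Qed.

Lemma bimod_extL (B : bimodType A) (phi : E -> B) a x :
  bimod_ext phi (a *L x) = a *L bimod_ext phi x.
Proof.
apply: (malg_additive_eq (f := fun a => bimod_ext phi (a *L x))
  (g := fun a => a *L bimod_ext phi x)) => {a} [a b|a b|c u].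
- by rewrite lactDl bimod_extD.
- exact: lactDl.
apply: (freeBimod_additive_eq (f := fun x => bimod_ext phi (<< c *g u >> *L x))
  (g := fun x => << c *g u >> *L bimod_ext phi x)) => {x} [x y|x y|d t].
- by rewrite lactDr bimod_extD.
- by rewrite bimod_extD lactDr.
by rewrite lact_ctri bimod_ext_ctri bimod_ext_ctri -lractA -lactM malgMU.
Qed.

Lemma bimod_extR (B : bimodType A) (phi : E -> B) x a :
  bimod_ext phi (x *R a) = bimod_ext phi x *R a.
Proof.
apply: (malg_additive_eq (f := fun a => bimod_ext phi (x *R a))
  (g := fun a => bimod_ext phi x *R a)) => {a} [a b|a b|c u].
- by rewrite ractDr bimod_extD.
- exact: ractDr.
apply: (freeBimod_additive_eq (f := fun x => bimod_ext phi (x *R << c *g u >>))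
  (g := fun x => bimod_ext phi x *R << c *g u >>)) => {x} [x y|x y|d t].
- by rewrite ractDl bimod_extD.
- by rewrite bimod_extD ractDl.
rewrite ract_ctri bimod_ext_ctri bimod_ext_ctri -ractM /triR /=.
have cA : (c%:A : A) = << c *g mone >> by rewrite -mul_malgC mulr1.
have -> : << d * c *g t.1.1 >> = c%:A * << d *g t.1.1 >> :> A.
  by rewrite cA malgMU mul1m mulrC.
have -> : << t.2 >> * << c *g u >> = << mmul t.2 u >> * c%:A :> A.
  by rewrite cA !malgMU mulm1.
by rewrite lactM lractA lractC -ractM.
Qed.


Lemma bimod_ext_comp (B C : bimodType A) (h : B -> C) (phi : E -> B) x :
    (forall p q, h (p + q) = h p + h q) -> (forall a p, h (a *L p) = a *L h p) ->
    (forall a p, h (p *R a) = h p *R a) ->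
  h (bimod_ext phi x) = bimod_ext (fun e => h (phi e)) x.
Proof.
move=> hD hL hR; have h0 : h 0 = 0 by apply: (addrI (h 0)); rewrite -hD !addr0.
rewrite bimod_ext.unlock (big_morph h hD h0).
by apply: eq_bigr => t _; rewrite hR hL.
Qed.
End FreeBimodule.

Section QuotientBimodule.
Context (K : fieldType) (A : lalgType K) (B : bimodType A) (G : B -> Prop).
Implicit Types (a b : A) (x y : B).

Inductive subbimod : B -> Prop :=
| subbimod_gen x : G x -> subbimod x
| subbimod0 : subbimod 0
| subbimodB x y : subbimod x -> subbimod y -> subbimod (x - y)
| subbimodL a x : subbimod x -> subbimod (a *L x)
| subbimodR a x : subbimod x -> subbimod (x *R a).

Definition subbimod_pred : {pred B} := fun x => `[< subbimod x >].

Fact subbimod_zmod_closed : zmod_closed subbimod_pred.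
Proof.
split=> [|x y /asboolP Sx /asboolP Sy]; apply/asboolP; first exact: subbimod0.
exact: subbimodB.
Qed.

HB.instance Definition _ :=
  GRing.isZmodClosed.Build B subbimod_pred subbimod_zmod_closed.

Definition bquot := Quotient.quot subbimod_pred.
HB.instance Definition _ := GRing.Zmodule.on bquot.

Definition bclass (x : B) : bquot := \pi_(Quotient.quot subbimod_pred) x.
Definition brepr (q : bquot) : B := repr (q : Quotient.quot subbimod_pred).

Lemma breprK q : bclass (brepr q) = q.
Proof. exact: reprK. Qed.

Lemma bclassP x y : bclass x = bclass y <-> subbimod (x - y).
Proof.
have -> : subbimod (x - y) <-> (x - y \in subbimod_pred).
  by split=> /asboolP.
by rewrite Quotient.idealrBE; split=> [e|/eqP e]; [apply/eqP|]; exact: e.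
Qed.

Lemma brepr_class x : subbimod (brepr (bclass x) - x).
Proof. by apply/bclassP; rewrite breprK. Qed.

Lemma bclassB x y : bclass (x - y) = bclass x - bclass y.
Proof. exact: raddfB. Qed.

Lemma bclassD x y : bclass (x + y) = bclass x + bclass y.
Proof. exact: raddfD. Qed.

Definition bquot_lact a (q : bquot) := bclass (a *L brepr q).
Definition bquot_ract (q : bquot) a := bclass (brepr q *R a).

Lemma bclassL a x : bclass (a *L x) = bquot_lact a (bclass x).
Proof.
apply/esym/bclassP; rewrite -lactBr; exact/subbimodL/brepr_class.
Qed.

Lemma bclassR x a : bclass (x *R a) = bquot_ract (bclass x) a.
Proof.
apply/esym/bclassP; rewrite -ractBl; exact/subbimodR/brepr_class.
Qed.

Lemma bquot_ind (P : bquot -> Prop) : (forall x, P (bclass x)) -> forall q, P q.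
Proof. by move=> Px q; rewrite -[q]breprK. Qed.

Local Notation ql := bquot_lact.
Local Notation qr := bquot_ract.

Fact bquot_lactM a b q : ql (a * b) q = ql a (ql b q).
Proof. by elim/bquot_ind: q => x; rewrite -!bclassL lactM. Qed.
Fact bquot_lact1 q : ql 1 q = q.
Proof. by elim/bquot_ind: q => x; rewrite -!bclassL lact1. Qed.
Fact bquot_lactDl a b q : ql (a + b) q = ql a q + ql b q.
Proof. by elim/bquot_ind: q => x; rewrite -!bclassL lactDl bclassD. Qed.
Fact bquot_lactDr a q r : ql a (q + r) = ql a q + ql a r.
Proof.
elim/bquot_ind: q => x; elim/bquot_ind: r => y.
by rewrite -bclassD -!bclassL lactDr bclassD.
Qed.
Fact bquot_ractM a b q : qr q (a * b) = qr (qr q a) b.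
Proof. by elim/bquot_ind: q => x; rewrite -!bclassR ractM. Qed.
Fact bquot_ract1 q : qr q 1 = q.
Proof. by elim/bquot_ind: q => x; rewrite -!bclassR ract1. Qed.
Fact bquot_ractDr a b q : qr q (a + b) = qr q a + qr q b.
Proof. by elim/bquot_ind: q => x; rewrite -!bclassR ractDr bclassD. Qed.
Fact bquot_ractDl a q r : qr (q + r) a = qr q a + qr r a.
Proof.
elim/bquot_ind: q => x; elim/bquot_ind: r => y.
by rewrite -bclassD -!bclassR ractDl bclassD.
Qed.
Fact bquot_lractA a b q : qr (ql a q) b = ql a (qr q b).
Proof.
elim/bquot_ind: q => x.
by rewrite -bclassL -!bclassR -bclassL lractA.
Qed.
Fact bquot_lractC (k : K) q : ql k%:A q = qr q k%:A.
Proof. by elim/bquot_ind: q => x; rewrite -bclassL -bclassR lractC. Qed.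

HB.instance Definition _ := isBimodule.Build K A bquot
  bquot_lactM bquot_lact1 bquot_lactDl bquot_lactDr bquot_ractM bquot_ract1
  bquot_ractDr bquot_ractDl bquot_lractA bquot_lractC.

(* A map invariant under subbimod passes to the quotient through brepr. *)
Lemma bquot_liftE (C : bimodType A) (f : B -> C) :
    (forall x y, f (x - y) = f x - f y) ->
    (forall a x, f (a *L x) = a *L f x) ->
    (forall a x, f (x *R a) = f x *R a) ->
    (forall x, G x -> f x = 0) ->
  forall x, f (brepr (bclass x)) = f x.
Proof.
move=> fB fL fR fG x; apply/eqP; rewrite -subr_eq0 -fB; apply/eqP.
elim: (brepr_class x) => {x} [x /fG //||x y _ IHx _ IHy|a x _ IHx|a x _ IHx].
- by have := fB 0 0; rewrite !subrr.
- by rewrite fB IHx IHy subrr.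
- by rewrite fL IHx lact0r.
- by rewrite fR IHx ract0l.
Qed.
End QuotientBimodule.

(* The relations by which the free 1- and 2-algebras are quotients of
   F (+) B, where F is the free bimodule on the generating cells and B the
   bimodule of cells one dimension below; iota sends a 0-cell to its (iterated)
   identity, and s0, t0 are the 0-dimensional source and target on F. *)
Section Interchange.
Context (K : fieldType) (X0 E : choiceType).
Local Notation A := (freeAlg K X0).
Local Notation F := (freeBimod K X0 E).
Context (B : bimodType A) (iota : A -> B) (s0 t0 : F -> A).

Definition in1 (x : F) : F * B := (x, 0).
Definition in2 (y : B) : F * B := (0, y).

Definition interchange (z : F * B) : Prop := exists a b : F,
  z = (in1 (a *R s0 b + t0 a *L b) - in2 (iota (t0 a * s0 b)))
    - (in1 (s0 a *L b + a *R t0 b) - in2 (iota (s0 a * t0 b))).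
End Interchange.
Arguments in1 {K X0 E B} x.
Arguments in2 {K X0 E B} y.

Section ExtendToSum.
Context (K : fieldType) (X0 E : choiceType).
Local Notation A := (freeAlg K X0).
Context (B : bimodType A).

Implicit Types (phi : E -> B) (x : freeBimod K X0 E) (y : B).

Definition sum_ext (phi : E -> B) (z : freeBimod K X0 E * B) : B :=
  bimod_ext phi z.1 + z.2.

Lemma sum_extB phi z z' : sum_ext phi (z - z') = sum_ext phi z - sum_ext phi z'.
Proof. by rewrite /sum_ext /= bimod_extB opprD addrACA. Qed.

Lemma sum_extD phi z z' : sum_ext phi (z + z') = sum_ext phi z + sum_ext phi z'.
Proof. by rewrite /sum_ext /= bimod_extD addrACA. Qed.

Lemma sum_extL phi a z : sum_ext phi (a *L z) = a *L sum_ext phi z.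
Proof. by rewrite /sum_ext /= bimod_extL lactDr. Qed.

Lemma sum_extR phi a z : sum_ext phi (z *R a) = sum_ext phi z *R a.
Proof. by rewrite /sum_ext /= bimod_extR ractDl. Qed.

Lemma sum_ext_in1 phi x : sum_ext phi (in1 x) = bimod_ext phi x.
Proof. exact: addr0. Qed.

Lemma sum_ext_in2 phi (y : B) : sum_ext phi (in2 y) = y.
Proof. by rewrite /sum_ext (bimod_ext0 phi) add0r. Qed.

Lemma sum_ext4 phi x y x' y' :
  sum_ext phi ((in1 x - in2 y) - (in1 x' - in2 y')) =
  (bimod_ext phi x - y) - (bimod_ext phi x' - y').
Proof.
by rewrite sum_extB 2!sum_extB !sum_ext_in1 !sum_ext_in2.
Qed.

Lemma bimod_extRL phi c x d (y : freeBimod K X0 E) :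
  bimod_ext phi (x *R c + d *L y) =
  bimod_ext phi x *R c + d *L bimod_ext phi y.
Proof. by rewrite bimod_extD bimod_extL bimod_extR. Qed.

Lemma bimod_extLR phi c x d (y : freeBimod K X0 E) :
  bimod_ext phi (c *L x + y *R d) =
  c *L bimod_ext phi x + bimod_ext phi y *R d.
Proof. by rewrite bimod_extD bimod_extL bimod_extR. Qed.

Lemma sum_ext_interchange phi (iota : A -> B) (s0 t0 : freeBimod K X0 E -> A) z :
  interchange iota s0 t0 z -> exists a b, sum_ext phi z =
    (bimod_ext phi a *R s0 b + t0 a *L bimod_ext phi b - iota (t0 a * s0 b))
  - (s0 a *L bimod_ext phi b + bimod_ext phi a *R t0 b - iota (s0 a * t0 b)).
Proof.
move=> [a [b ->]]; exists a, b; rewrite -(bimod_extRL phi) -(bimod_extLR phi).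
exact: sum_ext4.
Qed.
End ExtendToSum.

Lemma interchange_srcE (R : pzRingType) (sa ta sb tb : R) :
  (sa * sb + ta * sb - ta * sb) - (sa * sb + sa * tb - sa * tb) = 0.
Proof. by rewrite !addrK subrr. Qed.

Lemma interchange_tgtE (R : pzRingType) (sa ta sb tb : R) :
  (ta * sb + ta * tb - ta * sb) - (sa * tb + ta * tb - sa * tb) = 0.
Proof.
by rewrite [ta * sb + _]addrC [sa * tb + _]addrC !addrK subrr.
Qed.

Lemma pair_congr (S T : Type) (x x' : S) (y y' : T) :
  x = x' -> y = y' -> (x, y) = (x', y').
Proof. by move=> -> ->. Qed.

Lemma addr_cancel2 (V : zmodType) (p q r s u v : V) :
  (p + u + (q + v)) - (r + v + (s + u)) = (p + q) - (r + s).
Proof.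
rewrite (addrACA p u q v) (addrACA r v s u) (addrC v u) (opprD (r + s)).
by rewrite (addrACA (p + q)) subrr addr0.
Qed.

Lemma interchange_lhs (K : fieldType) (A : lalgType K) (V : bimodType A)
    (x y : V) (sx tx sy ty c d : A) :
  (x *R (sy + d) + (tx + c) *L y - 0) - ((sx + c) *L y + x *R (ty + d) - 0) =
  (x *R sy + tx *L y - 0) - (sx *L y + x *R ty - 0).
Proof. by rewrite !subr0 !lactDl !ractDr; exact: addr_cancel2. Qed.

Lemma interchange_rhs (R : pzRingType) (sx tx sy ty c d : R) :
  (c * (sy + d) + (tx + c) * d - (tx + c) * (sy + d))
    - ((sx + c) * d + c * (ty + d) - (sx + c) * (ty + d)) =
  (0 - tx * sy) - (0 - sx * ty).
Proof.
have E s t : c * (s + d) + (t + c) * d - (t + c) * (s + d) = c * d - t * s.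
  rewrite [(t + c) * (s + d)]mulrDr [X in _ - X]addrC opprD addrA addrK.
  by rewrite mulrDr mulrDl [t * s + _]addrC opprD addrA [c * s + _]addrC addrK.
rewrite E [(sx + c) * d + _]addrC E opprB addrC addrA addrNK.
by rewrite !sub0r opprK addrC.
Qed.

Record polygraph (K : fieldType) := Polygraph {
  pg0 : choiceType;
  pg1 : choiceType;
  pg_src : pg1 -> freeAlg K pg0;
  pg_tgt : pg1 -> freeAlg K pg0
}.

Section FreeOneAlgebra.
Context (K : fieldType) (X : polygraph K).
Local Notation M := {fmonom (pg0 X)}.
Local Notation A := (freeAlg K (pg0 X)).
Local Notation F1 := (freeBimod K (pg0 X) (pg1 X)).

Definition rel1 : F1 * A -> Prop :=
  interchange id (bimod_ext (@pg_src K X)) (bimod_ext (@pg_tgt K X)).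

Definition cell1 : Type := bquot rel1.
HB.instance Definition _ := GRing.Zmodule.on cell1.
HB.instance Definition _ := Bimodule.on cell1.

(* The values do not depend on the representative: src1_class, tgt1_class. *)
Definition src1 (f : cell1) : A := sum_ext (@pg_src K X) (brepr f).
Definition tgt1 (f : cell1) : A := sum_ext (@pg_tgt K X) (brepr f).

Definition id1 (a : A) : cell1 := bclass rel1 (in2 a).

Definition mono1 (u : M) (alpha : pg1 X) (v : M) : cell1 :=
  bclass rel1 (in1 (tri K u alpha v)).

(* The composite f *_0 g; only meaningful if tgt1 f = src1 g. *)
Definition comp1 (f g : cell1) : cell1 := f - id1 (tgt1 f) + g.

Fact rel1_src z : rel1 z -> sum_ext (@pg_src K X) z = 0.
Proof.
move=> /(sum_ext_interchange (@pg_src K X)) [a [b ->]].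
exact: interchange_srcE.
Qed.

Fact rel1_tgt z : rel1 z -> sum_ext (@pg_tgt K X) z = 0.
Proof.
move=> /(sum_ext_interchange (@pg_tgt K X)) [a [b ->]].
exact: interchange_tgtE.
Qed.

Lemma src1_class z : src1 (bclass rel1 z) = sum_ext (@pg_src K X) z.
Proof.
rewrite /src1 (bquot_liftE (f := sum_ext (@pg_src K X))) //.
- exact: sum_extB.
- exact: sum_extL.
- by move=> a x; exact: sum_extR.
- exact: rel1_src.
Qed.

Lemma tgt1_class z : tgt1 (bclass rel1 z) = sum_ext (@pg_tgt K X) z.
Proof.
rewrite /tgt1 (bquot_liftE (f := sum_ext (@pg_tgt K X))) //.
- exact: sum_extB.
- exact: sum_extL.
- by move=> a x; exact: sum_extR.
- exact: rel1_tgt.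
Qed.

Lemma src1_mono1 u alpha v :
  src1 (mono1 u alpha v) = << u >> * pg_src alpha * << v >>.
Proof. by rewrite /mono1 src1_class sum_ext_in1 bimod_ext_ctri. Qed.

Lemma tgt1_mono1 u alpha v :
  tgt1 (mono1 u alpha v) = << u >> * pg_tgt alpha * << v >>.
Proof. by rewrite /mono1 tgt1_class sum_ext_in1 bimod_ext_ctri. Qed.

Lemma class1B z z' : bclass rel1 z - bclass rel1 z' = bclass rel1 (z - z').
Proof. exact/esym/bclassB. Qed.

Lemma class1D z z' : bclass rel1 z + bclass rel1 z' = bclass rel1 (z + z').
Proof. exact/esym/bclassD. Qed.

Lemma class1L a z : a *L (bclass rel1 z : cell1) = bclass rel1 (a *L z).
Proof. exact/esym/bclassL. Qed.

Lemma class1R a z : (bclass rel1 z : cell1) *R a = bclass rel1 (z *R a).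
Proof. exact/esym/bclassR. Qed.

Lemma cell1_ind (P : cell1 -> Prop) :
  (forall x c, P (bclass rel1 (x, c))) -> forall f, P f.
Proof. by move=> Pz; elim/bquot_ind=> -[x c]. Qed.

Lemma src1D f g : src1 (f + g) = src1 f + src1 g.
Proof.
elim/bquot_ind: f => z; elim/bquot_ind: g => z'.
by rewrite class1D !src1_class sum_extD.
Qed.

Lemma tgt1D f g : tgt1 (f + g) = tgt1 f + tgt1 g.
Proof.
elim/bquot_ind: f => z; elim/bquot_ind: g => z'.
by rewrite class1D !tgt1_class sum_extD.
Qed.

Lemma src1L a f : src1 (a *L f) = a * src1 f.
Proof.
by elim/bquot_ind: f => z; rewrite class1L !src1_class sum_extL.
Qed.

Lemma tgt1L a f : tgt1 (a *L f) = a * tgt1 f.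
Proof.
by elim/bquot_ind: f => z; rewrite class1L !tgt1_class sum_extL.
Qed.

Lemma src1R a f : src1 (f *R a) = src1 f * a.
Proof.
by elim/bquot_ind: f => z; rewrite class1R !src1_class sum_extR.
Qed.

Lemma tgt1R a f : tgt1 (f *R a) = tgt1 f * a.
Proof.
by elim/bquot_ind: f => z; rewrite class1R !tgt1_class sum_extR.
Qed.

Lemma src1_id a : src1 (id1 a) = a.
Proof. by rewrite /id1 src1_class sum_ext_in2. Qed.

Lemma tgt1_id a : tgt1 (id1 a) = a.
Proof. by rewrite /id1 tgt1_class sum_ext_in2. Qed.

Lemma class1RL z z' e a b :
  (bclass rel1 z : cell1) *R a + b *L (bclass rel1 z' : cell1) - bclass rel1 e
  = bclass rel1 (z *R a + b *L z' - e).
Proof. by rewrite class1R class1L class1D class1B. Qed.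

Lemma class1LR z z' e a b :
  b *L (bclass rel1 z' : cell1) + (bclass rel1 z : cell1) *R a - bclass rel1 e
  = bclass rel1 (b *L z' + z *R a - e).
Proof. by rewrite class1R class1L class1D class1B. Qed.

Lemma interchange1 f g :
  f *R src1 g + tgt1 f *L g - id1 (tgt1 f * src1 g) =
  src1 f *L g + f *R tgt1 g - id1 (src1 f * tgt1 g).
Proof.
elim/cell1_ind: f => x c; elim/cell1_ind: g => y d.
rewrite !src1_class !tgt1_class /sum_ext /id1 /=.
apply: etrans (class1RL _ _ _ _ _) _.
apply: etrans _ (esym (class1LR _ _ _ _ _)).
apply/bclassP/subbimod_gen; exists x, y.
pose s := bimod_ext (@pg_src K X); pose t := bimod_ext (@pg_tgt K X).
exact: (pair_congr (interchange_lhs x y (s x) (t x) (s y) (t y) c d)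
  (interchange_rhs (s x) (t x) (s y) (t y) c d)).
Qed.
End FreeOneAlgebra.

Record cell_ext (K : fieldType) (X : polygraph K) := CellExt {
  ce_cell : choiceType;
  ce_src : ce_cell -> cell1 X;
  ce_tgt : ce_cell -> cell1 X;
  ce_src1 : forall y, src1 (ce_src y) = src1 (ce_tgt y);
  ce_tgt1 : forall y, tgt1 (ce_src y) = tgt1 (ce_tgt y)
}.

Section FreeTwoAlgebra.
Context (K : fieldType) (X : polygraph K) (Y : cell_ext X).
Local Notation A := (freeAlg K (pg0 X)).
Local Notation F2 := (freeBimod K (pg0 X) (ce_cell Y)).

(* Extensions to F2 of the 0-dimensional source and target of the y in Y. *)
Definition src0 : F2 -> A := bimod_ext (fun y => src1 (ce_src y)).
Definition tgt0 : F2 -> A := bimod_ext (fun y => tgt1 (ce_src y)).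

Definition rel2 : F2 * cell1 X -> Prop := interchange (@id1 K X) src0 tgt0.

Definition cell2 : Type := bquot rel2.
HB.instance Definition _ := GRing.Zmodule.on cell2.
HB.instance Definition _ := Bimodule.on cell2.

(* The values do not depend on the representative: src2_class, tgt2_class. *)
Definition src2 (f : cell2) : cell1 X := sum_ext (@ce_src K X Y) (brepr f).
Definition tgt2 (f : cell2) : cell1 X := sum_ext (@ce_tgt K X Y) (brepr f).

Lemma src0_src x : src0 x = src1 (bimod_ext (@ce_src K X Y) x).
Proof.
apply/esym/bimod_ext_comp.
- exact: src1D.
- exact: src1L.
- by move=> a f; exact: src1R.
Qed.

Lemma tgt0_src x : tgt0 x = tgt1 (bimod_ext (@ce_src K X Y) x).
Proof.
apply/esym/bimod_ext_comp.
- exact: tgt1D.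
- exact: tgt1L.
- by move=> a f; exact: tgt1R.
Qed.

Lemma src0_tgt x : src0 x = src1 (bimod_ext (@ce_tgt K X Y) x).
Proof.
have -> : src0 x = bimod_ext (fun y => src1 (ce_tgt y)) x.
  by congr bimod_ext; apply/funext => y; exact: ce_src1.
apply/esym/bimod_ext_comp.
- exact: src1D.
- exact: src1L.
- by move=> a f; exact: src1R.
Qed.

Lemma tgt0_tgt x : tgt0 x = tgt1 (bimod_ext (@ce_tgt K X Y) x).
Proof.
have -> : tgt0 x = bimod_ext (fun y => tgt1 (ce_tgt y)) x.
  by congr bimod_ext; apply/funext => y; exact: ce_tgt1.
apply/esym/bimod_ext_comp.
- exact: tgt1D.
- exact: tgt1L.
- by move=> a f; exact: tgt1R.
Qed.

Fact rel2_src z : rel2 z -> sum_ext (@ce_src K X Y) z = 0.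
Proof.
move=> /(sum_ext_interchange (@ce_src K X Y)) [a [b ->]].
rewrite !src0_src !tgt0_src interchange1; exact: subrr.
Qed.

Fact rel2_tgt z : rel2 z -> sum_ext (@ce_tgt K X Y) z = 0.
Proof.
move=> /(sum_ext_interchange (@ce_tgt K X Y)) [a [b ->]].
rewrite !src0_tgt !tgt0_tgt interchange1; exact: subrr.
Qed.

Lemma src2_class z : src2 (bclass rel2 z) = sum_ext (@ce_src K X Y) z.
Proof.
rewrite /src2 (bquot_liftE (f := sum_ext (@ce_src K X Y))) //.
- exact: sum_extB.
- exact: sum_extL.
- by move=> a x; exact: sum_extR.
- exact: rel2_src.
Qed.

Lemma tgt2_class z : tgt2 (bclass rel2 z) = sum_ext (@ce_tgt K X Y) z.
Proof.
rewrite /tgt2 (bquot_liftE (f := sum_ext (@ce_tgt K X Y))) //.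
- exact: sum_extB.
- exact: sum_extL.
- by move=> a x; exact: sum_extR.
- exact: rel2_tgt.
Qed.
End FreeTwoAlgebra.

Section Rewriting.
Context (K : fieldType) (X : polygraph K).
Local Notation M := {fmonom (pg0 X)}.
Local Notation A := (freeAlg K (pg0 X)).
Implicit Types (a b : A) (f g h k : cell1 X) (u v w : M).

(* b is a monomial of supp(a), monomials being seen as elements of A. *)
Definition in_supp b a : Prop := exists2 u, b = << u >> & u \in msupp a.

Definition left_monomial : Prop := forall alpha : pg1 X,
  (exists u, pg_src alpha = << u >>) /\ ~ in_supp (pg_src alpha) (pg_tgt alpha).

Definition is_mono1 f : Prop := exists u alpha v, f = mono1 u alpha v.

Definition rewriting_step f : Prop := exists (l : K) g a,
  [/\ is_mono1 g, l != 0, ~ in_supp (src1 g) a & f = l%:A *L g + id1 a].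

Inductive positive : cell1 X -> Prop :=
| positive_id a : positive (id1 a)
| positive_step f g : rewriting_step f -> positive g -> tgt1 f = src1 g ->
    positive (comp1 f g).

Inductive rew_gt : M -> M -> Prop :=
| rew_gt_cell alpha u v :
    pg_src alpha = << u >> -> v \in msupp (pg_tgt alpha) -> rew_gt u v
| rew_gt_mul w w' u v :
    rew_gt u v -> rew_gt (mmul (mmul w u) w') (mmul (mmul w v) w')
| rew_gt_trans u v w : rew_gt u v -> rew_gt v w -> rew_gt u w.

Definition terminating : Prop := well_founded (fun v u => rew_gt u v).

Definition branching f g : Prop :=
  [/\ positive f, positive g & src1 f = src1 g].

Definition local_branching f g : Prop :=
  [/\ branching f g, rewriting_step f & rewriting_step g].

Definition peiffer f g : Prop := exists f' g',
  [/\ is_mono1 f', is_mono1 g', f = f' *R src1 g' & g = src1 f' *L g'].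

Definition proper_context f g : Prop := exists u v f' g',
  [/\ (u, v) <> (mone, mone), branching f' g',
      f = << u >> *L f' *R << v >> & g = << u >> *L g' *R << v >>].

Definition critical_branching f g : Prop :=
  [/\ is_mono1 f, is_mono1 g & src1 f = src1 g] /\
  [/\ f <> g, ~ (peiffer f g \/ peiffer g f) & ~ proper_context f g].

Variable Y : cell_ext X.

Definition confluent f g : Prop := exists h k (F : cell2 Y),
  [/\ positive h, positive k, tgt1 f = src1 h & tgt1 g = src1 k] /\
  src2 F = comp1 f h /\ tgt2 F = comp1 g k.

Definition locally_confluent : Prop :=
  forall f g, local_branching f g -> confluent f g.

Definition critically_confluent : Prop :=
  forall f g, critical_branching f g -> confluent f g.
End Rewriting.

(* Main.v *)
Require Import Defs.
From HB Require Import structures.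
From mathcomp Require Import all_boot all_order all_algebra.
From mathcomp Require Import finmap boolp.
From mathcomp.multinomials Require Import monalg.

Set Implicit Arguments.
Unset Strict Implicit.
Unset Printing Implicit Defensive.

Import GRing.Theory.
Local Open Scope ring_scope.
Local Open Scope bimod_scope.

(** The source and target maps of 2-cells are morphisms of bimodules, so the
    differences s(F) - t(F) form a sub-bimodule of the 1-cells ([null]), and two
    1-cells are connected by a 2-cell exactly when they are congruent modulo it
    ([nullP]). Y-confluence thus becomes a statement about congruence of
    1-cells ([confluentP]).

    Since X terminates, every 0-cell has a positive 1-cell to a normal form
    ([normalization]). For each monomial m such a 1-cell nf m is chosen once and
    for all, and m |-> nf m is extended to a linear map [reduce] from 0-cells to
    1-cells. Say that a 1-cell f from a to b respects this map when reduce a is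
    congruent to the composite of f with reduce b. The respectful 1-cells form a
    vector space which contains the identities and is stable by composition.
    Linearity therefore absorbs all the difficulties of linear rewriting: if
    1-monomials are respectful, then so are rewriting steps and positive
    1-cells, and any branching closes by reducing both its targets to normal
    forms, for both composites are then congruent to reduce of the common source
    ([branching_confluent]).

    It remains to prove that 1-monomials are respectful ([monos_respected]). This
    goes by induction on the source w, along the union of the termination order
    and of the order of proper factors, which is well founded because the former
    is stable by contexts ([rew_factor_ind]). One respectful 1-monomial with
    source w is the first step of nf w ([first_step_respects]), so the point is
    that f - g is respectful for any two 1-monomials f and g with source w. If
    the branching (f, g) is Peiffer, the exchange relation rewrites f - g in
    terms of cells with smaller sources ([peiffer_respects]). If it is critical,
    it is Y-confluent by hypothesis, and the cells that close it have smaller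
    sources ([confluent_respects]). If it is (u f' v, u g' v) in a proper context,
    then (f', g') is Y-confluent by the induction hypothesis for the source of
    f' and the monomials below it, and (f, g) is so by applying the context. By
    the definition of critical branchings, these cases are exhaustive as soon as
    f and g differ. *)

(** * Monomial contexts in the free algebra *)

Section FreeAlgebra.
Context (K : fieldType) (X0 : choiceType).
Local Notation M := {fmonom X0}.
Local Notation A := (freeAlg K X0).
Implicit Types (u v w m : M) (a : A).

Lemma fmulI u : injective (mmul u).
Proof.
move=> m m' /(congr1 val) /=; rewrite !fmM => /eqP.
by rewrite eqseq_cat // eqxx /= => /eqP e; apply/eqP; rewrite fmP e.
Qed.

Lemma fmulIr v : injective (mmul^~ v).
Proof.
move=> m m' /(congr1 val) /=; rewrite !fmM => /eqP.
have [sz|/negP sz] := boolP (size m == size m' :> nat).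
  by rewrite eqseq_cat ?(eqP sz) // eqxx andbT => /eqP e; apply/eqP; rewrite fmP e.
move=> /eqP /(congr1 size); rewrite !size_cat => /addIn e; case: sz; exact/eqP.
Qed.

Lemma monom_inj : injective (fun u : M => << u >> : A).
Proof.
move=> u v /(congr1 (mcoeff u)); rewrite mcoeffUU mcoeffU.
by case: eqP => // _ /eqP; rewrite oner_eq0.
Qed.

Lemma scalar_monom (k : K) u : k%:A * << u >> = << k *g u >> :> A.
Proof.
have -> : k%:A = k%:MP :> A by rewrite -mul_malgC mulr1.
by rewrite malgMU mul1m mulr1.
Qed.

Lemma scalarE (k : K) a : k%:A * a = k *: a.
Proof. by rewrite -scalerAl mul1r. Qed.

Lemma mul_monom u v : << u >> * << v >> = << mmul u v >> :> A.
Proof. by rewrite malgMU mulr1. Qed.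

Lemma mcoeff_context u v a m :
  (<< u >> * a * << v >>)@_(mmul (mmul u m) v) = a@_m.
Proof.
apply: (malg_additive_eq
  (f := fun a : A => (<< u >> * a * << v >>)@_(mmul (mmul u m) v))
  (g := fun a : A => a@_m)) => {a} [a b|a b|c i].
- by rewrite mulrDr mulrDl mcoeffD.
- exact: mcoeffD.
rewrite !malgMU mul1r mulr1 !mcoeffU; congr (_ *+ nat_of_bool _).
by apply/eqP/eqP => [/fmulIr/fmulI|->].
Qed.

Lemma msupp_context u v a m : m \in msupp (<< u >> * a * << v >>) ->
  exists2 m', m' \in msupp a & m = mmul (mmul u m') v.
Proof.
move=> /msuppM_le [k1 [k2 [/msuppM_le [k3 [k4 [+ m4 ->]]] + ->]]].
by rewrite !msuppU1 !inE => /eqP -> /eqP ->; exists k4.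
Qed.

(** The source of a 1-cell that a context sends to a 1-monomial is a monomial,
    so that induction on proper factors applies to it. *)
Lemma context_eq_monom u v a w : << u >> * a * << v >> = << w >> ->
  exists2 w', a = << w' >> & w = mmul (mmul u w') v.
Proof.
move=> e; have : w \in msupp (<< u >> * a * << v >>) by rewrite e msuppU1 inE.
move=> /msupp_context [w' _ ew]; exists w' => //; apply/malgP => m.
rewrite -(mcoeff_context u v) e ew !mcoeffU; congr (_ *+ nat_of_bool _).
by apply/eqP/eqP => [/fmulIr/fmulI|->].
Qed.

(** Presents a as the source of a rewriting step at w. *)
Lemma monomial_split a w :
  exists2 b : A, a = << a@_w *g w >> + b & w \notin msupp b /\
    forall m, m \in msupp b -> m \in msupp a.
Proof.
exists (a - << a@_w *g w >>); first by rewrite addrC subrK.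
split=> [|m]; first by rewrite -mcoeff_eq0 mcoeffB mcoeffUU subrr.
rewrite -!mcoeff_neq0 mcoeffB mcoeffU.
case: (w =P m) => [<-|_]; last by rewrite mulr0n subr0.
by rewrite mulr1n subrr eqxx.
Qed.

End FreeAlgebra.

(** * Linear extension of maps into a bimodule *)

(** Restriction of scalars along K -> A, under which linear extension of maps
    applies to bimodules of cells. *)
Definition scalar_module (K : fieldType) (A : lalgType K) (V : bimodType A)
  : Type := V.

Section ScalarModule.
Context (K : fieldType) (A : lalgType K) (V : bimodType A).
Implicit Types (k : K) (v : V).

Let scal k v : V := k%:A *L v.

Fact scalar_moduleA k l v : scal k (scal l v) = scal (k * l) v.
Proof. by rewrite /scal -lactM -scalerAl mul1r scalerA. Qed.
Fact scalar_module1 v : scal 1 v = v.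
Proof. by rewrite /scal scale1r lact1. Qed.
Fact scalar_moduleDr k v w : scal k (v + w) = scal k v + scal k w.
Proof. exact: lactDr. Qed.
Fact scalar_moduleDl v k l : scal (k + l) v = scal k v + scal l v.
Proof. by rewrite /scal scalerDl lactDl. Qed.

HB.instance Definition _ := GRing.Zmodule.on (scalar_module V).
HB.instance Definition _ :=
  GRing.Zmodule_isLmodule.Build K (scalar_module V)
    scalar_moduleA scalar_module1 scalar_moduleDr scalar_moduleDl.

End ScalarModule.

Section LinearExtensionToBimodule.
Context (K : fieldType) (I : choiceType) (A : lalgType K) (V : bimodType A).
Implicit Types (phi psi : I -> V) (a : {malg K[I]}).

Definition bimod_linext phi (a : {malg K[I]}) : V :=
  linext (phi : I -> scalar_module V) a.

Lemma bimod_linextU phi k i : bimod_linext phi << k *g i >> = k%:A *L phi i.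
Proof. exact: (@linextU K I (scalar_module V)). Qed.
Lemma bimod_linextD phi a b :
  bimod_linext phi (a + b) = bimod_linext phi a + bimod_linext phi b.
Proof. exact: (@linextD K I (scalar_module V)). Qed.
Lemma bimod_linextZ phi k a :
  bimod_linext phi (k *: a) = k%:A *L bimod_linext phi a.
Proof. exact: (@linextZ K I (scalar_module V)). Qed.
Lemma bimod_linextU1 phi i : bimod_linext phi << i >> = phi i.
Proof. by rewrite bimod_linextU scale1r lact1. Qed.

Lemma bimod_linextB phi a b :
  bimod_linext phi (a - b) = bimod_linext phi a - bimod_linext phi b.
Proof. by apply: (addIr (bimod_linext phi b)); rewrite -bimod_linextD !addrNK. Qed.

Lemma bimod_linext0 phi : bimod_linext phi 0 = 0.
Proof. by rewrite -(subrr 0) bimod_linextB subrr. Qed.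

Lemma bimod_linext_closed (P : V -> Prop) phi a :
    P 0 -> (forall x y, P x -> P y -> P (x + y)) ->
    (forall k x, P x -> P (k%:A *L x)) ->
  (forall i, i \in msupp a -> P (phi i)) -> P (bimod_linext phi a).
Proof.
move=> P0 PD PZ Pphi; rewrite /bimod_linext linext.unlock big_seq.
elim/big_ind: _ => // i /Pphi; exact: PZ.
Qed.

Lemma eq_bimod_linext phi psi a :
  (forall i, i \in msupp a -> phi i = psi i) ->
  bimod_linext phi a = bimod_linext psi a.
Proof.
move=> e; rewrite /bimod_linext linext.unlock; apply: eq_big_seq => i /e.
by move=> /= ->.
Qed.

Lemma bimod_linext_unique phi (h : {malg K[I]} -> V) a :
    (forall a b, h (a + b) = h a + h b) ->
    (forall k i, h << k *g i >> = k%:A *L phi i) -> h a = bimod_linext phi a.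
Proof.
move=> hD hU; apply: malg_additive_eq a => // [a b|k i]; first exact: bimod_linextD.
by rewrite bimod_linextU.
Qed.

End LinearExtensionToBimodule.

(** * Identities in groups and bimodules *)

(** Calculations with composites f - i + g, where i and j stand for identity
    cells, and with n - f + i - n', where n and n' stand for the images of the
    source and target of f by a linear map. *)
Section ZmodIdentities.
Context (V : zmodType).
Implicit Types p q r s : V.

Lemma addr_subD_subK (t f g : V) : t + (f - (f - g + t)) = g.
Proof. by rewrite opprD opprB addrCA addrC (addrC t) subrK subrK. Qed.

Lemma deviation_add p p' q q' r r' s s' :
  (p + p') - (q + q') + (r + r') - (s + s') =
  (p - q + r - s) + (p' - q' + r' - s').
Proof.
by rewrite !opprD (addrACA p) (addrACA (p - q)) (addrACA (p - q + r)).
Qed.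

Lemma deviation_comp (n n' f g i : V) :
  (n - f + i - n') + (n' - g) = n - (f - i + g).
Proof. by rewrite addrA subrK !opprD opprK !addrA. Qed.

Lemma comp_diff (f i h g j k : V) :
  f - g = (f - i + h - (g - j + k)) + ((i - h) - (j - k)).
Proof.
have -> : f - g = (f - i + h + (i - h)) - (g - j + k + (j - k)).
  by congr (_ - _); rewrite addrACA subrr addr0 addrNK.
by rewrite opprD addrACA.
Qed.

Lemma interchange_diff (p q i r s j : V) :
  p + q - i = r + s - j -> p - r = (s - j) - (q - i).
Proof.
move=> e; apply: (addIr (q - i)); rewrite subrK addrAC addrA e.
by rewrite addrAC [r + s]addrC addrK.
Qed.

Lemma first_step_identity (f i h n : V) : - (n - h) = f - i + h - f + i - n.
Proof.
rewrite opprB [f - i + h]addrAC [X in X + i]addrAC subrK.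
by rewrite [f + h]addrC addrK.
Qed.

End ZmodIdentities.

Lemma deviation_lact (K : fieldType) (A : lalgType K) (V : bimodType A)
    (a : A) (n f i n' : V) :
  a *L n - a *L f + a *L i - a *L n' = a *L (n - f + i - n').
Proof. by rewrite lactBr lactDr lactBr. Qed.

Lemma affine_context (K : fieldType) (X0 : choiceType)
    (V : bimodType (freeAlg K X0)) (a b : freeAlg K X0) (k : K) (x y : V) :
  a *L (k%:A *L x + y) *R b = k%:A *L (a *L x *R b) + a *L y *R b.
Proof. by rewrite lactDr ractDl -lactM -freeAlg_lractC lactM lractA. Qed.

Lemma context_sub (K : fieldType) (X0 : choiceType)
    (V : bimodType (freeAlg K X0)) (a b : freeAlg K X0) (x y : V) :
  a *L (x - y) *R b = a *L x *R b - a *L y *R b.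
Proof. by rewrite lactBr ractBl. Qed.

(** * Operations on 1-cells *)
Section OneCells.
Context (K : fieldType) (X : polygraph K).
Local Notation M := {fmonom (pg0 X)}.
Local Notation A := (freeAlg K (pg0 X)).
Implicit Types (f g h k : cell1 X) (u v w m : M) (a b : A).

Lemma id1D a b : id1 (a + b) = id1 a + id1 b :> cell1 X.
Proof.
by rewrite /id1 class1D; congr bclass; apply: pair_congr => //; rewrite addr0.
Qed.

Lemma id1B a b : id1 (a - b) = id1 a - id1 b :> cell1 X.
Proof. by apply: (addIr (id1 b)); rewrite -id1D !addrNK. Qed.

Lemma id1_0 : id1 0 = 0 :> cell1 X.
Proof. by rewrite -(subrr 0) id1B subrr. Qed.

Lemma id1L a b : a *L (id1 b : cell1 X) = id1 (a * b).
Proof.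
by rewrite /id1 class1L; congr bclass; apply/pair_congr => //; apply: lact0r.
Qed.

Lemma id1R a b : (id1 b : cell1 X) *R a = id1 (b * a).
Proof.
by rewrite /id1 class1R; congr bclass; apply/pair_congr => //; apply: ract0l.
Qed.

Lemma id1_context a b c : a *L (id1 c : cell1 X) *R b = id1 (a * c * b).
Proof. by rewrite id1L id1R. Qed.

Lemma src1B f g : src1 (f - g) = src1 f - src1 g.
Proof. by apply: (addIr (src1 g)); rewrite -src1D !addrNK. Qed.

Lemma tgt1B f g : tgt1 (f - g) = tgt1 f - tgt1 g.
Proof. by apply: (addIr (tgt1 g)); rewrite -tgt1D !addrNK. Qed.

Lemma src1_comp f g : tgt1 f = src1 g -> src1 (comp1 f g) = src1 f.
Proof. by move=> e; rewrite /comp1 src1D src1B src1_id e addrNK. Qed.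

Lemma tgt1_comp f g : tgt1 (comp1 f g) = tgt1 g.
Proof. by rewrite /comp1 tgt1D tgt1B tgt1_id subrr add0r. Qed.

Lemma comp1_context a b f g :
  a *L comp1 f g *R b = comp1 (a *L f *R b) (a *L g *R b).
Proof.
rewrite /comp1 lactDr ractDl lactBr ractBl; congr (_ - _ + _).
by rewrite tgt1R tgt1L -id1R -id1L.
Qed.

Lemma mono1_context u v w alpha w' :
  << u >> *L mono1 w alpha w' *R << v >> =
  mono1 (mmul u w) alpha (mmul w' v) :> cell1 X.
Proof.
rewrite /mono1 class1L class1R; congr bclass; apply: pair_congr.
  apply: etrans (congr1 (fun x => x *R _) (lact_ctri _ _ _ _)) _.
  by apply: etrans (ract_ctri _ _ _ _) _; rewrite !mulr1.
by rewrite /= lactE ractE mulr0 mul0r.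
Qed.

Lemma is_mono1_context u v f :
  is_mono1 f -> is_mono1 (<< u >> *L f *R << v >>).
Proof. by move=> [w [alpha [w' ->]]]; rewrite mono1_context; do 3!eexists. Qed.

End OneCells.

(** * Congruence of 1-cells modulo 2-cells *)
Section TwoCells.
Context (K : fieldType) (X : polygraph K) (Y : cell_ext X).
Local Notation A := (freeAlg K (pg0 X)).
Implicit Types (F G : cell2 Y) (f g h k x y : cell1 X) (a b : A).

Lemma class2D z z' :
  (bclass (@rel2 K X Y) z : cell2 Y) + bclass (@rel2 K X Y) z' =
  bclass (@rel2 K X Y) (z + z').
Proof. exact/esym/bclassD. Qed.

Lemma class2L a z : a *L (bclass (@rel2 K X Y) z : cell2 Y) =
  bclass (@rel2 K X Y) (a *L z).
Proof. exact/esym/bclassL. Qed.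

Lemma class2R a z : (bclass (@rel2 K X Y) z : cell2 Y) *R a =
  bclass (@rel2 K X Y) (z *R a).
Proof. exact/esym/bclassR. Qed.

Lemma src2D F G : src2 (F + G) = src2 F + src2 G.
Proof.
elim/bquot_ind: F => z; elim/bquot_ind: G => z'.
by rewrite class2D !src2_class sum_extD.
Qed.

Lemma tgt2D F G : tgt2 (F + G) = tgt2 F + tgt2 G.
Proof.
elim/bquot_ind: F => z; elim/bquot_ind: G => z'.
by rewrite class2D !tgt2_class sum_extD.
Qed.

Lemma src2L a F : src2 (a *L F) = a *L src2 F.
Proof. by elim/bquot_ind: F => z; rewrite class2L !src2_class sum_extL. Qed.

Lemma tgt2L a F : tgt2 (a *L F) = a *L tgt2 F.
Proof. by elim/bquot_ind: F => z; rewrite class2L !tgt2_class sum_extL. Qed.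

Lemma src2R a F : src2 (F *R a) = src2 F *R a.
Proof. by elim/bquot_ind: F => z; rewrite class2R !src2_class sum_extR. Qed.

Lemma tgt2R a F : tgt2 (F *R a) = tgt2 F *R a.
Proof. by elim/bquot_ind: F => z; rewrite class2R !tgt2_class sum_extR. Qed.

Definition id2 f : cell2 Y := bclass (@rel2 K X Y) (in2 f).

Lemma src2_id f : src2 (id2 f) = f.
Proof. by rewrite src2_class sum_ext_in2. Qed.

Lemma tgt2_id f : tgt2 (id2 f) = f.
Proof. by rewrite tgt2_class sum_ext_in2. Qed.

Lemma src1_src2 F : src1 (src2 F) = src1 (tgt2 F).
Proof.
elim/bquot_ind: F => -[x c].
by rewrite src2_class tgt2_class /sum_ext !src1D -src0_src -src0_tgt.
Qed.

Lemma tgt1_src2 F : tgt1 (src2 F) = tgt1 (tgt2 F).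
Proof.
elim/bquot_ind: F => -[x c].
by rewrite src2_class tgt2_class /sum_ext !tgt1D -tgt0_src -tgt0_tgt.
Qed.

(** The sub-bimodule of 1-cells generated by the boundaries s(y) - t(y) of the
    generating 2-cells. *)
Definition null x : Prop := exists F, src2 F - tgt2 F = x.

(** Adding the identity 2-cell of f - s(F) to F changes its source and target by
    the same amount, so only the difference s(F) - t(F) matters. *)
Lemma nullP f g : null (f - g) <-> exists F, src2 F = f /\ tgt2 F = g.
Proof.
split=> [[F e]|[F [<- <-]]]; last by exists F.
exists (F + id2 (f - src2 F)); rewrite src2D tgt2D src2_id tgt2_id.
split; first by rewrite addrC subrK.
have -> : src2 F = f - g + tgt2 F by rewrite -e subrK.
exact: addr_subD_subK.
Qed.

Lemma null0 : null 0.
Proof. by exists (id2 0); rewrite src2_id tgt2_id subrr. Qed.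

Lemma nullD x y : null x -> null y -> null (x + y).
Proof.
by move=> [F <-] [G <-]; exists (F + G); rewrite src2D tgt2D opprD addrACA.
Qed.

Lemma nullL a x : null x -> null (a *L x).
Proof. by move=> [F <-]; exists (a *L F); rewrite src2L tgt2L lactBr. Qed.

Lemma nullR a x : null x -> null (x *R a).
Proof. by move=> [F <-]; exists (F *R a); rewrite src2R tgt2R ractBl. Qed.

Lemma nullN x : null x -> null (- x).
Proof.
move=> /(nullL (-1)); congr null.
by apply: (addIr x); rewrite -{2}[x]lact1 -lactDl !addNr lact0l.
Qed.

Lemma nullB x y : null x -> null y -> null (x - y).
Proof. by move=> nx /nullN; apply: nullD. Qed.

Lemma src1_null x : null x -> src1 x = 0.
Proof. by move=> [F <-]; rewrite src1B src1_src2 subrr. Qed.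

Lemma tgt1_null x : null x -> tgt1 x = 0.
Proof. by move=> [F <-]; rewrite tgt1B tgt1_src2 subrr. Qed.

Lemma confluentP f g : confluent Y f g <-> exists h k,
  [/\ positive h, positive k, tgt1 f = src1 h, tgt1 g = src1 k
    & null (comp1 f h - comp1 g k)].
Proof.
split=> [[h [k [F [[ph pk fh gk] [sF tF]]]]]|[h [k [ph pk fh gk]]]].
  by exists h, k; split=> //; apply/nullP; exists F.
by move=> /nullP [F [sF tF]]; exists h, k, F.
Qed.

End TwoCells.

(** * Termination and normal forms *)
Section Rewriting.
Context (K : fieldType) (X : polygraph K).
Local Notation M := {fmonom (pg0 X)}.
Local Notation A := (freeAlg K (pg0 X)).
Implicit Types (f g h k : cell1 X) (u v w m : M) (a b : A) (S : M -> Prop).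

Definition reducible m : Prop := exists2 f, is_mono1 f & src1 f = << m >> :> A.
Definition normal a : Prop := forall m, m \in msupp a -> ~ reducible m.
Definition supported S a : Prop := forall m, m \in msupp a -> S m.
Definition rew_closed S : Prop := forall w m, rew_gt w m -> S w -> S m.

(** If w rewrites to m inside a context, then so does the whole word: passing to
    a factor and rewriting it can be replayed as rewriting first and passing to a
    factor afterwards. Hence the inner induction on the length of factors can be
    run under the outer induction on rewriting, even though a rewriting step may
    turn a factor into a longer word. *)
Lemma rew_factor_ind (P : M -> Prop) : terminating X ->
    (forall w, (forall m, rew_gt w m -> P m) ->
      (forall u w' v, (u, v) <> (mone, mone) -> w = mmul (mmul u w') v -> P w') ->
      P w) ->
  forall w, P w.
Proof.
move=> wf step w.
suff Q : forall u w' v, w = mmul (mmul u w') v -> P w'.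
  by apply: (Q mone w mone); rewrite mul1m mulm1.
elim/(well_founded_ind wf): w => w IHw u w'.
have [n] := ubnP (size w'); elim: n => // n IHn in u w' * => sz v ew.
apply: step => [m w'm|p w'' q pq ew'].
  by apply: (IHw (mmul (mmul u m) v)) (erefl); rewrite ew; apply: rew_gt_mul.
apply: (IHn (mmul u p) w'' _ (mmul q v)); last by rewrite ew ew' !mulmA.
rewrite ltnS in sz; apply: leq_trans sz; rewrite ew' !fmM !size_cat.
rewrite -addnA addnCA -[X in (X < _)%N]addn0 ltn_add2l lt0n addn_eq0.
apply/negP => /andP [/eqP/fdeg_eq0I p1 /eqP/fdeg_eq0I q1].
by apply: pq; rewrite p1 q1.
Qed.

Lemma rewriting_stepP f : left_monomial X -> rewriting_step f ->
  exists c g w a, [/\ is_mono1 g, src1 g = << w >>, c != 0, w \notin msupp a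
    & f = c%:A *L g + id1 a].
Proof.
move=> lm [c [g [a [mg c0 ga ->]]]]; case: (mg) => u [alpha [v eg]].
have [[s es] _] := lm alpha.
have sg : src1 g = << mmul (mmul u s) v >> by rewrite eg src1_mono1 es !mul_monom.
exists c, g, (mmul (mmul u s) v), a; split=> //.
by apply/negP => wa; apply: ga; exists (mmul (mmul u s) v).
Qed.

Lemma src1_step c g w a : src1 g = << w >> ->
  src1 (c%:A *L g + id1 a) = << c *g w >> + a.
Proof. by move=> e; rewrite src1D src1L src1_id e scalar_monom. Qed.

Lemma mem_src1_step c g w a : src1 g = << w >> -> c != 0 -> w \notin msupp a ->
  w \in msupp (src1 (c%:A *L g + id1 a)).
Proof.
move=> sg c0 wa; rewrite (src1_step _ _ sg) -mcoeff_neq0 mcoeffD mcoeffUU.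
by rewrite (mcoeff_outdom wa) addr0.
Qed.

Hypothesis lm : left_monomial X.

Lemma mono1P f : is_mono1 f ->
  exists2 w, src1 f = << w >> & forall m, m \in msupp (tgt1 f) -> rew_gt w m.
Proof.
move=> [u [alpha [v ->]]]; have [[s es] _] := lm alpha.
exists (mmul (mmul u s) v); first by rewrite src1_mono1 es !mul_monom.
move=> m; rewrite tgt1_mono1 => /msupp_context [m' m't ->].
by apply: rew_gt_mul; apply: rew_gt_cell es m't.
Qed.

Lemma mono1_rew_gt f w m :
  is_mono1 f -> src1 f = << w >> -> m \in msupp (tgt1 f) -> rew_gt w m.
Proof. by move=> /mono1P [w' -> h] /monom_inj <-; apply: h. Qed.

Lemma rewriting_step_context u v f :
  rewriting_step f -> rewriting_step (<< u >> *L f *R << v >>).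
Proof.
move=> /(rewriting_stepP lm) [c [g [w [a [mg sg c0 wa ->]]]]].
exists c, (<< u >> *L g *R << v >>), (<< u >> * a * << v >>); split=> //.
- exact: is_mono1_context.
- rewrite src1R src1L sg !mul_monom => -[m /monom_inj <-].
  by move=> /msupp_context [w' w'a /fmulIr/fmulI e]; rewrite e w'a in wa.
by rewrite -id1_context; exact: affine_context.
Qed.

Lemma positive_context u v f :
  positive f -> positive (<< u >> *L f *R << v >>).
Proof.
elim=> [a|{}f g sf _ pg fg]; first by rewrite id1_context; apply: positive_id.
rewrite comp1_context; apply: positive_step pg _.
  exact: rewriting_step_context.
by rewrite tgt1R tgt1L fg src1R src1L.
Qed.

Lemma positive_normal f : positive f -> normal (src1 f) -> f = id1 (src1 f).
Proof.
case=> [a|{}f g sf _ fg]; first by rewrite src1_id.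
have [c [f0 [w [a [mf sf0 c0 wa ef]]]]] := rewriting_stepP lm sf.
rewrite src1_comp // ef => /(_ w (mem_src1_step sf0 c0 wa)) []; by exists f0.
Qed.

(** In a step from a single monomial, the coefficient is 1 and the added
    0-cell is 0: the step is a 1-monomial. *)
Lemma positive_reducible f w : positive f -> src1 f = << w >> ->
    normal (tgt1 f) -> reducible w ->
  exists g h, [/\ is_mono1 g, positive h, src1 g = << w >>, tgt1 g = src1 h
    & f = comp1 g h].
Proof.
case=> [a|{}f h sf ph fh].
  by rewrite src1_id tgt1_id => -> /(_ w); rewrite msuppU1 inE eqxx => /(_ isT).
have [c [g [m [a [mg sg c0 ma ef]]]]] := rewriting_stepP lm sf.
rewrite src1_comp // => e _ _; rewrite ef (src1_step _ _ sg) in e.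
have em : w = m.
  have := mem_src1_step sg c0 ma; rewrite (src1_step _ _ sg) e msuppU1 inE.
  by move/eqP.
have c1 : c = 1.
  move: e => /(congr1 (mcoeff m)); rewrite mcoeffD mcoeffUU (mcoeff_outdom ma).
  by rewrite addr0 em mcoeffUU.
have a0 : a = 0 by apply: (addrI << c *g m >>); rewrite e c1 em addr0.
have eg : f = g by rewrite ef c1 a0 scale1r lact1 id1_0 addr0.
exists g, h; split; [exact: mg|exact: ph|by rewrite sg em| |by rewrite eg].
by rewrite -eg.
Qed.

(** Consider the finite sets s of monomials such that every 0-cell whose
    reducible monomials all lie in s has a normal form. Adding a monomial w
    preserves this property, by well-founded induction on w: one step trades w for
    finitely many smaller monomials, which can be added to s one after the other.
    This avoids extending the termination order to multisets of monomials. *)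
Lemma normalization a : terminating X ->
  exists h, [/\ positive h, src1 h = a & normal (tgt1 h)].
Proof.
move=> wf; pose nrm a := exists h, [/\ positive h, src1 h = a & normal (tgt1 h)].
pose G (s : seq M) :=
  forall a, (forall m, m \in msupp a -> m \in s \/ ~ reducible m) -> nrm a.
suff Gs : forall s, G s by apply: (Gs (msupp a)) => m; left.
have G_cons : forall w s, G s -> G (w :: s).
  elim/(well_founded_ind wf) => w IHw s Gs {}a sa.
  have [[wa [f mf sf]]|wa] := pselect (w \in msupp a /\ reducible w); last first.
    apply: Gs => m ma; have [rm|] := pselect (reducible m); last by right.
    left; case: (sa m ma) => //; rewrite inE => /orP [/eqP em|//].
    by case: wa; rewrite -em.
  have [b ea [wb ba]] := monomial_split a w.
  set c := a@_w in ea; have c0 : c != 0 by rewrite mcoeff_neq0.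
  pose st := c%:A *L f + id1 b.
  have Gt : G (msupp (tgt1 f) ++ s).
    have : forall m, m \in (msupp (tgt1 f) : seq M) -> rew_gt w m.
      by move=> m; apply: mono1_rew_gt.
    elim: (msupp _ : seq M) => //= m r IHr rw.
    apply: IHw; first by apply: rw; rewrite inE eqxx.
    by apply: IHr => m' m'r; apply: rw; rewrite inE m'r orbT.
  have [m|h [ph sh nh]] := Gt (tgt1 st).
    rewrite /st tgt1D tgt1L tgt1_id => /(fsubsetP (msuppD_le _ _)).
    rewrite inE mem_cat scalarE => /orP [/(fsubsetP (msuppZ_le _ _)) ->|mb].
      by left.
    case: (sa m (ba _ mb)); last by right.
    rewrite inE => /orP [/eqP em|->]; last by left; rewrite orbT.
    by rewrite -em mb in wb.
  exists (comp1 st h); rewrite tgt1_comp src1_comp //; split=> //.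
    apply: positive_step => //; exists c, f, b; split=> //.
    by rewrite sf => -[m /monom_inj <-] mb; rewrite mb in wb.
  by rewrite /st (src1_step _ _ sf) -ea.
elim=> [{}a sa|w s]; last exact: G_cons.
exists (id1 a); rewrite src1_id tgt1_id; split=> //; first exact: positive_id.
by move=> m ma; case: (sa m ma).
Qed.

Lemma confluent_context (Y : cell_ext X) u v f g : confluent Y f g ->
  confluent Y (<< u >> *L f *R << v >>) (<< u >> *L g *R << v >>).
Proof.
move=> /confluentP [h [k [ph pk fh gk n]]]; apply/confluentP.
exists (<< u >> *L h *R << v >>), (<< u >> *L k *R << v >>); split.
- exact: positive_context.
- exact: positive_context.
- by rewrite tgt1R tgt1L fh src1R src1L.
- by rewrite tgt1R tgt1L gk src1R src1L.
have e := congr2 (fun x y => x - y)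
  (comp1_context << u >> << v >> f h) (comp1_context << u >> << v >> g k).
exact: (eq_ind _ (null Y) (nullR _ (nullL _ n)) _ (etrans (context_sub _ _ _ _) e)).
Qed.

End Rewriting.

(** * The linear normal form map and the cells that respect it *)
Section NormalFormMap.
Context (K : fieldType) (X : polygraph K) (Y : cell_ext X).
Local Notation M := {fmonom (pg0 X)}.
Local Notation A := (freeAlg K (pg0 X)).
Implicit Types (f g h k x : cell1 X) (u v w m : M) (a b : A) (S : M -> Prop).

Hypothesis lm : left_monomial X.
Variable nf : M -> cell1 X.
Hypothesis nf_positive : forall m, positive (nf m).
Hypothesis src1_nf : forall m, src1 (nf m) = << m >>.
Hypothesis nf_normal : forall m, normal (tgt1 (nf m)).

(** Monomials are reduced independently of each other, so reduce a is in general
    not positive. *)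
Definition reduce (a : A) : cell1 X := bimod_linext nf a.

Lemma reduceU m : reduce << m >> = nf m.
Proof. exact: bimod_linextU1. Qed.

Lemma reduce_normal a : normal a -> reduce a = id1 a.
Proof.
move=> na; transitivity (bimod_linext (fun m => id1 << m >> : cell1 X) a).
  apply: eq_bimod_linext => m ma.
  rewrite (positive_normal lm (nf_positive m)) src1_nf //.
  by move=> m'; rewrite msuppU1 inE => /eqP ->; apply: na.
apply/esym/bimod_linext_unique => [b c|k m]; first exact: id1D.
by rewrite id1L scalar_monom.
Qed.

(** The difference of reduce (src1 f) and comp1 f (reduce (tgt1 f)), written so
    that it is visibly additive in f. *)
Definition deviation f : cell1 X :=
  reduce (src1 f) - f + id1 (tgt1 f) - reduce (tgt1 f).

Definition respects f : Prop := null Y (deviation f).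

Lemma deviationD f g : deviation (f + g) = deviation f + deviation g.
Proof.
rewrite /deviation src1D tgt1D id1D /reduce !bimod_linextD; exact: deviation_add.
Qed.

Lemma deviationZ c f : deviation (c%:A *L f) = c%:A *L deviation f.
Proof.
rewrite /deviation src1L tgt1L /reduce.
rewrite scalarE bimod_linextZ scalarE bimod_linextZ -scalarE -id1L.
exact: deviation_lact.
Qed.

Lemma respects_id a : respects (id1 a).
Proof.
by rewrite /respects /deviation src1_id tgt1_id addrNK subrr; exact: null0.
Qed.

Lemma respectsD f g : respects f -> respects g -> respects (f + g).
Proof. by rewrite /respects deviationD; exact: nullD. Qed.

Lemma respectsZ c f : respects f -> respects (c%:A *L f).
Proof. by rewrite /respects deviationZ; exact: nullL. Qed.

Lemma respects0 : respects 0.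
Proof. by rewrite -id1_0; exact: respects_id. Qed.

Lemma respectsN f : respects f -> respects (- f).
Proof.
move=> /(respectsZ (-1)); congr respects.
by apply: (addIr f); rewrite -{2}[f]lact1 addNr scaleN1r -lactDl addNr lact0l.
Qed.

Lemma respectsB f g : respects f -> respects g -> respects (f - g).
Proof. by move=> rf /respectsN; exact: respectsD. Qed.

Lemma respects_comp f g : respects f -> respects g -> respects (comp1 f g).
Proof.
by move=> rf rg; apply: respectsD rg; apply: respectsB rf _; exact: respects_id.
Qed.

Lemma respects_null x : null Y x -> respects x.
Proof.
move=> nx; rewrite /respects /deviation (src1_null nx) (tgt1_null nx) id1_0.
by rewrite /reduce bimod_linext0 subr0 addr0 sub0r; exact: nullN.
Qed.

Definition mono_respected w : Prop :=
  forall f, is_mono1 f -> src1 f = << w >> -> respects f.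

Section ClosedSet.
Variable S : M -> Prop.
Hypothesis closedS : rew_closed S.
Hypothesis monoS : forall w, S w -> mono_respected w.

(** By induction on the length: a rewriting step is a linear combination of a
    1-monomial with source in S and an identity. *)
Lemma respects_positive f : positive f -> supported S (src1 f) ->
  respects f /\ supported S (tgt1 f).
Proof.
elim=> [a|{}f g sf pg IHg fg].
  by rewrite src1_id tgt1_id; split=> //; exact: respects_id.
rewrite src1_comp // tgt1_comp => Sf.
have [c [f0 [w [a [mf sf0 c0 wa ef]]]]] := rewriting_stepP lm sf.
have Sw : S w by apply: Sf; rewrite ef; exact: mem_src1_step sf0 c0 wa.
have [|rg Sg] := IHg; last first.
  split=> //; apply: respects_comp rg; rewrite ef.
  by apply: respectsD (respects_id a); apply/respectsZ/(monoS Sw).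
rewrite -fg ef => m; rewrite tgt1D tgt1L tgt1_id => /(fsubsetP (msuppD_le _ _)).
rewrite inE scalarE => /orP [/(fsubsetP (msuppZ_le _ _))|] ma.
  by apply: closedS Sw; exact: mono1_rew_gt mf sf0 ma.
by apply: Sf; rewrite ef (src1_step _ _ sf0) -mcoeff_neq0 mcoeffD mcoeffU;
  case: (w =P m) => [e|_]; [rewrite e ma in wa | rewrite add0r mcoeff_neq0].
Qed.

Lemma positive_reduce h : positive h -> normal (tgt1 h) ->
  supported S (src1 h) -> null Y (reduce (src1 h) - h).
Proof.
move=> ph nh /(respects_positive ph) [+ _].
by rewrite /respects /deviation (reduce_normal nh) addrK.
Qed.

Hypothesis wf : terminating X.

(** Reducing the target of f to normal form by a positive 1-cell h costs nothing,
    as h itself is congruent to reduce (tgt1 f). *)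
Lemma positive_completion f : positive f -> supported S (src1 f) ->
  exists h, [/\ positive h, tgt1 f = src1 h
    & null Y (reduce (src1 f) - comp1 f h)].
Proof.
move=> pf Sf; have [rf Stf] := respects_positive pf Sf.
have [h [ph sh nh]] := normalization lm (tgt1 f) wf.
exists h; split=> //; rewrite -(deviation_comp _ (reduce (tgt1 f))) -sh.
apply: nullD; first by rewrite sh.
by apply: positive_reduce => //; rewrite sh.
Qed.

(** The completions of f and g are congruent to reduce of the same 0-cell. *)
Lemma branching_confluent f g :
  branching f g -> supported S (src1 f) -> confluent Y f g.
Proof.
move=> [pf pg fg] Sf; apply/confluentP.
have [h [ph fh nh]] := positive_completion pf Sf.
have [|k [pk gk nk]] := positive_completion pg; first by rewrite -fg.
exists h, k; split=> //; have := nullB nk nh.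
by rewrite fg opprB addrC addrA subrK.
Qed.

(** The cells that close the branching are respectful and boundaries of 2-cells
    are too, hence so is what remains of the difference of the two composites. *)
Lemma confluent_respects f g : confluent Y f g ->
  supported S (tgt1 f) -> supported S (tgt1 g) -> respects (f - g).
Proof.
move=> /confluentP [h [k [ph pk fh gk n]]] Sf Sg.
rewrite (comp_diff f (id1 (tgt1 f)) h g (id1 (tgt1 g)) k).
apply: respectsD; first exact: respects_null.
have [|rh _] := respects_positive ph; first by rewrite -fh.
have [|rk _] := respects_positive pk; first by rewrite -gk.
by apply: respectsB; apply: respectsB => //; exact: respects_id.
Qed.

End ClosedSet.

Lemma respects_lact a g :
  (forall m, m \in msupp a -> respects (<< m >> *L g)) -> respects (a *L g).
Proof.
move=> rm.
rewrite (bimod_linext_unique (phi := fun m => << m >> *L g) (h := fun a => a *L g)).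
- exact: bimod_linext_closed respects0 respectsD respectsZ rm.
- by move=> b c; exact: lactDl.
- by move=> c m; rewrite -lactM scalar_monom.
Qed.

Lemma respects_ract a f :
  (forall m, m \in msupp a -> respects (f *R << m >>)) -> respects (f *R a).
Proof.
move=> rm.
rewrite (bimod_linext_unique (phi := fun m => f *R << m >>) (h := fun a => f *R a)).
- exact: bimod_linext_closed respects0 respectsD respectsZ rm.
- by move=> b c; exact: ractDr.
- by move=> c m; rewrite -scalar_monom ractM -lractC lractA.
Qed.

(** Write f = f' s(g') and g = s(f') g'. Up to identities, the exchange relation
    equates f - g with f' t(g') - t(f') g', and expanding t(g') and t(f') yields
    1-monomials whose sources are smaller than w. *)
Lemma peiffer_respects f g w : peiffer f g -> src1 f = << w >> ->
  (forall m, rew_gt w m -> mono_respected m) -> respects (f - g).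
Proof.
move=> [f' [g' [mf mg -> ->]]] + rw; rewrite src1R.
have [wf sf tf] := mono1P lm mf; have [wg sg tg] := mono1P lm mg.
rewrite sf sg mul_monom => /monom_inj ew.
have := interchange1 f' g'; rewrite sf sg => e.
rewrite (interchange_diff e).
apply: respectsB; (apply: respectsB; last exact: respects_id).
  apply: respects_ract => m /tg wgm.
  apply: (rw (mmul wf m)).
  - by rewrite -ew -[mmul wf m]mulm1 -[mmul wf wg]mulm1; apply: rew_gt_mul.
  - by have := is_mono1_context mone m mf; rewrite (lact1 f').
  - by rewrite src1R sf mul_monom.
apply: respects_lact => m /tf wfm.
apply: (rw (mmul m wg)).
- by rewrite -ew -[mmul m wg]mul1m -[mmul wf wg]mul1m !mulmA; apply: rew_gt_mul.
- have := is_mono1_context m mone mg; by rewrite (ract1 (_ *L g')).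
- by rewrite src1L sg mul_monom.
Qed.

(** The 1-monomial that starts the chosen reduction of w is respectful: the rest h
    of the reduction is congruent to reduce (src1 h), as the monomials of src1 h
    are below w. *)
Lemma first_step_respects f h w : is_mono1 f -> src1 f = << w >> ->
    positive h -> tgt1 f = src1 h -> nf w = comp1 f h ->
  (forall m, rew_gt w m -> mono_respected m) -> respects f.
Proof.
move=> mf sf ph fh ew below.
have belowC : rew_closed (rew_gt w).
  by move=> v m vm wv; apply: rew_gt_trans wv vm.
have nh : normal (tgt1 h) by have := nf_normal (m := w); rewrite ew tgt1_comp.
have Sh : supported (rew_gt w) (src1 h).
  by rewrite -fh => m; apply: mono1_rew_gt.
have := nullN (positive_reduce belowC below ph nh Sh).
congr (null Y _); rewrite /deviation sf reduceU ew -fh.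
exact: first_step_identity.
Qed.

(** Induction along rewriting and proper factors, applied to the monomials below
    w as well as to w, because closing a branching with source a proper factor of
    w requires the monomials below this factor. *)
Lemma monos_respected w : terminating X -> critically_confluent Y ->
  mono_respected w.
Proof.
move=> wf crit; pose P w := forall m, m = w \/ rew_gt w m -> mono_respected m.
suff : P w by apply; left.
apply: (rew_factor_ind (P := P) wf) => {}w IHgt factor.
have below m : rew_gt w m -> mono_respected m.
  by move=> wm; apply: (IHgt m wm); left.
move=> m0 [->|]; last exact: below.
have belowC : rew_closed (rew_gt w).
  by move=> v m vm wv; apply: rew_gt_trans wv vm.
have monoB f g : is_mono1 f -> is_mono1 g -> src1 f = << w >> ->
    src1 g = << w >> -> respects (f - g).
  move=> mf mg sf sg.
  have conf_resp : confluent Y f g -> respects (f - g).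
    move=> /(confluent_respects belowC below); apply.
      by move=> m; apply: mono1_rew_gt.
    by move=> m; apply: mono1_rew_gt.
  have [->|fg] := pselect (f = g); first by rewrite subrr; exact: respects0.
  have [pei|pei] := pselect (peiffer f g \/ peiffer g f).
    case: pei => pei; first exact: peiffer_respects pei sf below.
    by rewrite -opprB; apply/respectsN/(peiffer_respects pei sg).
  (* Here f' and g' are positive but need not be 1-monomials: their confluence
     comes from branching_confluent, not from a hypothesis on 1-monomials. *)
  have [[u [v [f' [g' [uv br ef eg]]]]]|ctx] := pselect (proper_context f g).
    apply: conf_resp; rewrite ef eg; apply: confluent_context => //.
    move: sf; rewrite ef src1R src1L => /context_eq_monom [w' sf' ew].
    apply: (branching_confluent (S := fun m => m = w' \/ rew_gt w' m)) => //.
    - by move=> m m' mm' [<-|wm]; right; [|apply: rew_gt_trans wm mm'].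
    - exact: factor uv ew.
    by rewrite sf' => m; rewrite msuppU1 inE => /eqP ->; left.
  apply/conf_resp/crit; split; split=> //; by rewrite sf sg.
have [rw|nrw] := pselect (reducible w); last first.
  by move=> f mf sf; case: nrw; exists f.
have [f0 [h [mf0 ph sf0 fh ef0]]] :=
  positive_reducible lm (nf_positive w) (src1_nf w) (nf_normal (m := w)) rw.
move=> f mf sf; rewrite -(subrK f0 f); apply: respectsD; first exact: monoB.
exact: first_step_respects mf0 sf0 ph fh ef0 below.
Qed.

End NormalFormMap.

Theorem theorem4p2p1 (K : fieldType) (X : polygraph K) (Y : cell_ext X) :
  left_monomial X -> terminating X ->
  critically_confluent Y -> locally_confluent Y.
Proof.
move=> lm wf crit f g [br _ _].
have [nf nfP] := choice (fun m : {fmonom (pg0 X)} => normalization lm << m >> wf).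
have nf_pos m : positive (nf m) by case: (nfP m).
have src1_nf m : src1 (nf m) = << m >> by case: (nfP m).
have nf_normal m : normal (tgt1 (nf m)) by case: (nfP m).
pose S (m : {fmonom (pg0 X)}) := True.
have monos w : S w -> mono_respected Y nf w.
  by move=> _; exact: (monos_respected lm nf_pos src1_nf nf_normal wf crit).
have closedS : rew_closed S by [].
have := branching_confluent lm nf_pos src1_nf closedS monos wf br.
by apply.
Qed.
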